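(* Let $n=1+4K$ be a prime, with $K$ a positive integer. If there exist positive integers $b,\mu,\kappa$ such that $$K=\mu\bigl(\kappa(4b-1)-1\bigr)-\kappa b,$$ then there exist positive integers $a,d,z$ with $d\mid a^2$ and $$(4a-1)z-n(d+a)=0.$$ *)

(* Defs.v *)
From Stdlib Require Export ZArith Znumtheory.

(* Main.v *)
Require Import Defs.
From Stdlib Require Import ZArith Znumtheory Lia.
Local Open Scope Z_scope.

(** Put [m = 4 * b - 1] and choose [a] with [4 * a - 1 = n * m].  The relation on [K] makes [a]
    factor as [(kappa * m - 1) * (mu * m - b)]; for the divisor [d = mu * m - b] this gives
    [d + a = kappa * m * d], so [z = kappa * d] works. *)

Theorem mainTheorem3 (n K : Z) (hK : 0 < K) (hnK : n = 1 + 4 * K) (hn : prime n)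
    (h : exists b mu kappa : Z,
        0 < b /\ 0 < mu /\ 0 < kappa /\
        K = mu * (kappa * (4 * b - 1) - 1) - kappa * b) :
  exists a d z : Z,
    0 < a /\ 0 < d /\ 0 < z /\
    (d | a ^ 2) /\ (4 * a - 1) * z - n * (d + a) = 0.
Proof.
  destruct h as (b & mu & kappa & hb & hmu & hkappa & hKeq).
  set (d := mu * (4 * b - 1) - b).
  set (x := kappa * (4 * b - 1) - 1).
  assert (hx : 0 < x) by (unfold x; nia).
  (* The right-hand side is the [a] of the overview: since [n = 1 + 4 * K], four times it minus one
     is [(4 * K + 1) * (4 * b - 1) = n * m]. *)
  assert (ha : x * d = K * (4 * b - 1) + b) by (unfold x, d; rewrite hKeq; ring).
  (* In the form [K * m + b] no subtraction outside [m] remains, so positivity is immediate; as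
     [0 < x], it then passes from the product to the factor [d]. *)
  assert (ha0 : 0 < x * d).
  { rewrite ha; apply Z.add_pos_pos; [apply Z.mul_pos_pos |]; lia. }
  assert (hd : 0 < d) by exact (proj1 (Z.mul_pos_cancel_l x d hx) ha0).
  exists (x * d), d, (kappa * d).
  repeat split.
  - exact ha0.
  - exact hd.
  - now apply Z.mul_pos_pos.
  - exists (x * x * d); ring.
  - unfold x, d; rewrite hnK, hKeq; ring.
Qed.
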